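(* Let $(X,\mathcal W,\mu)$ be a space with measured walls that is $\mu$-locally finite. The following are equivalent: (1) there are constants $\delta,M\ge 0$ such that the Hausdorff distance from $\iota(X)$ to the associated median space $\mathcal M(X)$ is at most $\delta$ and all the half-spaces of $X$ are $(2\delta,M)$-quasi-convex; (2) there are constants $\delta,M\ge 0$ such that there exist a median space $\mathcal M$ and a monomorphism $\varphi:X\to\mathcal M$ such that $\mathcal M$ is within Hausdorff distance at most $\delta$ from $\varphi(X)$, and all the half-spaces of $X$ are $(2\delta,M)$-quasi-convex; (3) there are constants $\delta,M\ge 0$ such that $X$ with the wall pseudo-metric is $\delta$-tripodic and all the half-spaces of $X$ are $(2\delta,M)$-quasi-convex; (4) $X$ has $(\epsilon,K)$-gated half-spaces for some constants $\epsilon>0$ and $K\ge 0$.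
   Context: **Walls.** A wall of a set $X$ is a partition $w=\{h,h^c\}$ of $X$ ($h$ may be empty or all of $X$); $h,h^c$ are its half-spaces. Given a collection $\mathcal W$ of walls, $\mathcal H$ denotes the set of all half-spaces of walls in $\mathcal W$ and $\mathfrak p:\mathcal H\to\mathcal W$, $h\mapsto\{h,h^c\}$. A wall separates $A,B\subseteq X$ if $A\subseteq h$, $B\subseteq h^c$ or vice versa; $\mathcal W(A|B)$ is the set of walls in $\mathcal W$ separating $A$ and $B$, and $\mathcal W(x|y)=\mathcal W(\{x\}|\{y\})$. For $Y\subseteq X$, $\mathcal W(Y)$ is the set of walls separating two points of $Y$ (walls that cut, or intersect, $Y$). A space with measured walls $(X,\mathcal W,\mu)$ is a set $X$ with a collection $\mathcal W$ of walls, a $\sigma$-algebra $\mathcal B$ on $\mathcal W$ and a measure $\mu$ on $\mathcal B$ such that $\mathcal W(x|y)\in\mathcal B$ has finite measure for all $x,y\in X$. The wall pseudo-metric is $\mathrm{pdist}_\mu(x,y)=\mu(\mathcal W(x|y))$; all metric notions on $X$ refer to it. The $\sigma$-algebra and measure are pulled back to $\mathcal H$ via $\mathfrak p$: the measurable sets of $\mathcal H$ are $\mathfrak p^{-1}(E)$, $E\in\mathcal B$, with $\mu(\mathfrak p^{-1}(E))=\mu(E)$. A possibly non-measurable set of walls is said to have measure at most $K$ if all its measurable subsets have measure at most $K$. $X$ is $\mu$-locally finite if for every $R>0$ there is $M(R)<\infty$ such that $\mathcal W(B(x,R))$ has measure at most $M(R)$ for every $x\in X$, where $B(x,R)$ is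 the open ball. **Monomorphisms.** A map $\phi:X\to X'$ between spaces with measured walls $(X,\mathcal W,\mu)$, $(X',\mathcal W',\mu')$ is a homomorphism if for every $w'=\{h',h'^c\}\in\mathcal W'$ the wall $\phi^*(w')=\{\phi^{-1}(h'),\phi^{-1}(h'^c)\}$ is in $\mathcal W$, and $\phi^*:\mathcal W'\to\mathcal W$ is measurable with $(\phi^* )_*\mu'=\mu$. It is a monomorphism if moreover $\phi^*$ is surjective. In (2), the median space $\mathcal M$ is regarded as a space with measured walls via a structure of measured walls whose wall pseudo-metric is the median metric. **Metric notions.** $I_\delta(a,b)=\{t:\mathrm{pdist}(a,t)+\mathrm{pdist}(t,b)\le\mathrm{pdist}(a,b)+\delta\}$, $I(a,b)=I_0(a,b)$. A pseudo-metric space is $\delta$-tripodic if $I_{2\delta}(x,y)\cap I_{2\delta}(y,z)\cap I_{2\delta}(z,x)\ne\emptyset$ for all $x,y,z$. A subset $Y$ is $(\delta,M)$-quasi-convex if $I_\delta(a,b)\subseteq\{x:\mathrm{pdist}(x,Y)\le M\}$ for all $a,b\in Y$. An $\epsilon$-projection of $x$ on $A$ is a point $p\in A$ with $\mathrm{pdist}(x,p)<\mathrm{pdist}(x,A)+\epsilon$. $X$ has $(\epsilon,K)$-gated half-spaces if for every half-space $h\in\mathcal H$, every point $x\notin h$ and every $\epsilon$-projection $p$ of $x$ on $h$, the set $\mathcal W(x|p)\cap\mathcal W(h)$ of walls separating $x$ from $p$ and intersecting $h$ has measure at most $K$. **Median spaces.** A median space is a metric space in which for every $x,y,z$ the set $I(x,y)\cap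 I(y,z)\cap I(x,z)$ consists of exactly one point. **Associated median space.** An admissible section is a set $\sigma\subseteq\mathcal H$ containing exactly one half-space of each wall and such that $h\in\sigma$, $h\subset h'$, $h'\in\mathcal H$ imply $h'\in\sigma$. For $x\in X$ let $\sigma_x=\{h\in\mathcal H:x\in h\}$. Fix $x_0\in X$; $\mathcal M(X)$ is the metric space obtained from the set of admissible sections $\sigma$ with $\sigma\vartriangle\sigma_{x_0}$ measurable of finite measure, with pseudo-metric $\mathrm{pdist}_\mu(\sigma,\tau)=\mu(\sigma\vartriangle\tau)$, by identifying points at distance $0$. It is independent of $x_0$ and is a median space; $\iota:X\to\mathcal M(X)$, $x\mapsto[\sigma_x]$, is distance-preserving.
   Formalization: Hausdorff distance at most δ means each point has a point of the other set at distance ≤ δ (attained); in (2), if a wall of X separates points at distance 0, the median space may be only pseudo-metric (medians unique up to distance 0). The literal equivalence fails in both respects. *)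

(* Defs.v *)
From HB Require Import structures.
From mathcomp Require Import all_boot all_order all_algebra.
From mathcomp Require Import all_classical all_reals all_analysis.

Set Implicit Arguments.
Unset Strict Implicit.
Unset Printing Implicit Defensive.

Import Order.TTheory GRing.Theory Num.Theory.

Local Open Scope classical_set_scope.
Local Open Scope ring_scope.

Section PseudoMetric.
Context {R : realType} {T : Type} (d : T -> T -> R).

Definition oball (x : T) (r : R) : set T := [set y | d x y < r].

(* [inf] is junk on the empty set; below, [A] is always inhabited. *)
Definition dist_to (x : T) (A : set T) : R := inf [set d x y | y in A].

Definition interval (delta : R) (a b : T) : set T :=
  [set t | d a t + d t b <= d a b + delta].

Definition tripodic (delta : R) : Prop := forall x y z : T,
  interval (2 * delta) x y `&` interval (2 * delta) y z
    `&` interval (2 * delta) z x !=set0.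

Definition quasi_convex (delta M : R) (Y : set T) : Prop :=
  forall a b : T, Y a -> Y b ->
    interval delta a b `<=` [set x | dist_to x Y <= M].

Definition eps_projection (eps : R) (x : T) (A : set T) (p : T) : Prop :=
  A p /\ d x p < dist_to x A + eps.

(* The bound is attained: each point of one set has a point of the other one
   at distance at most [delta].  This matters because the same [delta] is a
   parameter of the quasi-convexity of half-spaces. *)
Definition hausdorff_le (A B : set T) (delta : R) : Prop :=
  (forall a, A a -> exists2 b, B b & d a b <= delta) /\
  (forall b, B b -> exists2 a, A a & d a b <= delta).

Definition separates_points : Prop := forall x y : T, d x y = 0 -> x = y.

(* Exactly one median point, up to points at distance 0; together with
   [separates_points] this says that [(T, d)] is a median space. *)
Definition median : Prop := forall x y z : T,
  exists2 m, (interval 0 x y `&` interval 0 y z `&` interval 0 x z) m &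
    forall t, (interval 0 x y `&` interval 0 y z `&` interval 0 x z) t ->
      d m t = 0.

(* The metric space obtained by identifying points at distance 0. *)
Definition mquot : Type :=
  {C : set T | exists x, C = [set y | d x y = 0]}.

Definition mproj (x : T) : mquot :=
  exist _ [set y | d x y = 0] (ex_intro _ x erefl).

Definition mrepr (C : mquot) : T := projT1 (cid (projT2 C)).

Definition mquot_dist (C D : mquot) : R := d (mrepr C) (mrepr D).

End PseudoMetric.

Definition wall_of {X : Type} (h : set X) : set (set X) := [set h; ~` h].

(* [wmeasurable] is a sigma-algebra on the set [walls].  A measure on it is
   represented by an extension to the sigma-algebra that [wmeasurable]
   generates on the ambient type [set (set X)]; that one differs from
   [wmeasurable] only by the presence of the complement of [walls], on which
   the value of [wmu] plays no role. *)
Record measured_walls (R : realType) (X : Type) := MeasuredWalls {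
  walls : set (set (set X)) ;
  walls_partition : forall w, walls w -> exists h : set X, w = wall_of h ;
  wmeasurable : set (set (set (set X))) ;
  wmeasurable_sub : forall E, wmeasurable E -> E `<=` walls ;
  wmeasurable_sigma : sigma_algebra walls wmeasurable ;
  wmu : {measure set (g_sigma_algebraType wmeasurable) -> \bar R} ;
  wsep_measurable : forall x y : X,
    wmeasurable (walls `&` [set w | exists2 h, w h & h x /\ ~ h y]) ;
  wsep_finite : forall x y : X,
    (wmu (walls `&` [set w | exists2 h, w h & h x /\ ~ h y]) < +oo)%E }.

Section MeasuredWalls.
Context {R : realType} {X : Type} (W : measured_walls R X).

Definition halfspaces : set (set X) := \bigcup_(w in walls W) w.

(* [h] ranges over both half-spaces of [w], which accounts for the
   "or vice versa" in the definition of separation. *)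
Definition wsep (A B : set X) : set (set (set X)) :=
  walls W `&` [set w | exists2 h, w h & A `<=` h /\ B `<=` ~` h].

Definition wcut (Y : set X) : set (set (set X)) :=
  [set w | exists x y, [/\ Y x, Y y & wsep [set x] [set y] w]].

Definition pdist (x y : X) : R := fine (wmu W (wsep [set x] [set y])).

Definition measure_at_most (A : set (set (set X))) (K : R) : Prop :=
  forall E, wmeasurable W E -> E `<=` A -> (wmu W E <= K%:E)%E.

Definition locally_finite : Prop := forall r : R, 0 < r ->
  exists M : R, forall x : X, measure_at_most (wcut (oball pdist x r)) M.

Definition gated_halfspaces (eps K : R) : Prop :=
  forall (h : set X) (x p : X), halfspaces h -> ~ h x ->
    eps_projection pdist eps x h p ->
    measure_at_most (wsep [set x] [set p] `&` wcut h) K.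

Definition halfspaces_quasi_convex (delta M : R) : Prop :=
  forall h : set X, halfspaces h -> quasi_convex pdist delta M h.

Definition hpreimage (E : set (set (set X))) : set (set X) :=
  halfspaces `&` wall_of @^-1` E.

Definition hmeasurable (S : set (set X)) : Prop :=
  exists2 E, wmeasurable W E & S = hpreimage E.

(* If [S = hpreimage E] with [E `<=` walls W], then [wall_of @` S = E]. *)
Definition hmu (S : set (set X)) : \bar R := wmu W (wall_of @` S).

Definition symdiff (s t : set (set X)) : set (set X) :=
  (s `\` t) `|` (t `\` s).

Definition admissible_section (s : set (set X)) : Prop :=
  [/\ s `<=` halfspaces,
      forall w, walls W w -> exists! h, w h /\ s h &
      forall h h', s h -> h `<=` h' -> halfspaces h' -> s h'].

Definition section_of (x : X) : set (set X) := halfspaces `&` [set h | h x].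

Definition msection (x0 : X) : Type :=
  {s : set (set X) | [/\ admissible_section s,
     hmeasurable (symdiff s (section_of x0)) &
     (hmu (symdiff s (section_of x0)) < +oo)%E]}.

Definition msection_dist (x0 : X) (s t : msection x0) : R :=
  fine (hmu (symdiff (projT1 s) (projT1 t))).

Definition median_of (x0 : X) : Type := mquot (@msection_dist x0).

Definition median_of_dist (x0 : X) : median_of x0 -> median_of x0 -> R :=
  @mquot_dist R _ (@msection_dist x0).

End MeasuredWalls.

Section Iota.
Context {R : realType} {X : Type} (W : measured_walls R X).

Lemma wall_ofC (h : set X) : wall_of (~` h) = wall_of h.
Proof. by rewrite /wall_of setCK setUC. Qed.

Lemma wall_of_mem (w : set (set X)) (h : set X) :
  walls W w -> w h -> w = wall_of h.
Proof.
by move=> /walls_partition[k ->] [->//|->]; rewrite wall_ofC.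
Qed.

Lemma section_of_admissible (x : X) : admissible_section W (section_of W x).
Proof.
split=> [h [] //|w Ww|h h' [_ hx] hh' Hh']; last by split=> //; exact: hh'.
have [k wk] := walls_partition Ww.
have [kx|nkx] := pselect (k x).
  exists k; split.
    by split; [rewrite wk; left|split=> //; exists w=> //; rewrite wk; left].
  by move=> h' [+ [_ h'x]]; rewrite wk => -[->//|h'k]; rewrite h'k in h'x.
exists (~` k); split.
  by split; [rewrite wk; right|split=> //; exists w=> //; rewrite wk; right].
by move=> h' [+ [_ h'x]]; rewrite wk => -[h'k|->//]; rewrite h'k in h'x.
Qed.

Lemma wsep_pointE (x y : X) : wsep W [set x] [set y] =
  walls W `&` [set w | exists2 h, w h & h x /\ ~ h y].
Proof.
rewrite /wsep; congr (_ `&` _); apply/seteqP; split=> w [h wh [hx hy]].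
  by exists h => //; split; [exact: hx|exact: hy].
by exists h => //; split=> [_ ->//|_ ->//].
Qed.

Lemma symdiff_section_of (x y : X) :
  symdiff (section_of W x) (section_of W y)
  = hpreimage W (wsep W [set x] [set y]).
Proof.
rewrite wsep_pointE; apply/seteqP; split=> h.
  move=> [[[[w Ww wh] hx] nhy]|[[[w Ww wh] hy] nhx]].
    split; first by exists w.
    rewrite /preimage /= -(wall_of_mem Ww wh); split=> //; exists h => //.
    by split=> // hy; apply: nhy; split=> //; exists w.
  split; first by exists w.
  rewrite /preimage /= -(wall_of_mem Ww wh); split=> //; exists (~` h).
    by rewrite (wall_of_mem Ww wh); right.
  by split=> [hx|nhy]; [apply: nhx; split=> //; exists w|exact: nhy].
move=> [Hh [Ww [k [->|->] [kx nky]]]].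
  by left; split=> // -[].
by right; split=> [|[_ /kx]//]; split=> //; exact: contrapT.
Qed.

Lemma wall_of_hpreimage (E : set (set (set X))) :
  E `<=` walls W -> wall_of @` hpreimage W E = E.
Proof.
move=> EW; apply/seteqP; split=> [_ [h [_ Eh] <-]//|w Ew].
have [h wh] := walls_partition (EW _ Ew).
exists h => //; split; last by rewrite /preimage /= -wh.
by exists w; [exact: EW|rewrite wh; left].
Qed.

Lemma section_of_finite (x0 x : X) :
  [/\ admissible_section W (section_of W x),
      hmeasurable W (symdiff (section_of W x) (section_of W x0)) &
      (hmu W (symdiff (section_of W x) (section_of W x0)) < +oo)%E].
Proof.
have mE : wmeasurable W (wsep W [set x] [set x0]).
  by rewrite wsep_pointE; exact: wsep_measurable.
split; first exact: section_of_admissible.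
  by exists (wsep W [set x] [set x0]) => //; exact: symdiff_section_of.
rewrite symdiff_section_of /hmu wall_of_hpreimage; last by move=> ? [].
by rewrite wsep_pointE; exact: wsep_finite.
Qed.

Definition miota (x0 x : X) : median_of W x0 :=
  mproj (@msection_dist _ _ W x0) (exist _ _ (section_of_finite x0 x)).

End Iota.

Section Morphisms.
Context {R : realType} {X Y : Type}.
Context (W : measured_walls R X) (V : measured_walls R Y) (phi : X -> Y).

Definition wall_pullback (v : set (set Y)) : set (set X) :=
  [set phi @^-1` h | h in v].

Definition homomorphism : Prop :=
  (forall v, walls V v -> walls W (wall_pullback v)) /\
  (forall E, wmeasurable W E ->
     wmeasurable V (walls V `&` wall_pullback @^-1` E) /\
     wmu V (walls V `&` wall_pullback @^-1` E) = wmu W E).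

Definition monomorphism : Prop :=
  homomorphism /\ set_surj (walls V) (walls W) wall_pullback.

End Morphisms.

Definition null_walls_absent (R : realType) (X : Type)
    (W : measured_walls R X) : Prop :=
  forall x y : X, pdist W x y = 0 -> wsep W [set x] [set y] = set0.

(* If two points of [X] at distance 0 are separated by a wall, then [X] has no
   monomorphism to a space with measured walls whose wall pseudo-metric is a
   metric: such a map identifies the two points, hence that wall is not a
   pullback. *)
Lemma monomorphism_null_walls_absent (R : realType) (X Y : Type)
    (W : measured_walls R X) (V : measured_walls R Y) (phi : X -> Y) :
  monomorphism W V phi -> separates_points (pdist V) -> null_walls_absent W.
Proof.
move=> [[hw hmu] surj] sepV x y xy0.
have E : wsep V [set phi x] [set phi y] =
    walls V `&` wall_pullback phi @^-1` wsep W [set x] [set y].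
  rewrite !wsep_pointE; apply/seteqP; split=> v [Vv].
    move=> [k vk [kx ky]]; split=> //; split; first exact: hw.
    by exists (phi @^-1` k) => //; exists k.
  by move=> [_ [_ [k vk <-] [kx ky]]]; split=> //; exists k.
have phixy : phi x = phi y.
  apply: sepV; rewrite -xy0 /pdist E.
  by rewrite (hmu _ _).2 // wsep_pointE; exact: wsep_measurable.
apply/seteqP; split=> // w; rewrite wsep_pointE => -[/surj[v Vv <-]].
by move=> [_ [k vk <-]] [] /=; rewrite /preimage /= phixy.
Qed.

(* A median space, regarded as a space with measured walls whose wall
   pseudo-metric is the median metric, and receiving a monomorphism from [X].
   It is a metric space, except if the previous lemma excludes this; in that
   case its points at distance 0 are not identified. *)
Definition median_target (R : realType) (X Y : Type)
    (W : measured_walls R X) (V : measured_walls R Y) : Prop :=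
  median (pdist V) /\ (null_walls_absent W -> separates_points (pdist V)).

(* Main.v *)
Require Import Defs.
From mathcomp Require Import all_boot all_order all_algebra.
From mathcomp Require Import all_classical all_reals all_analysis.
From mathcomp Require Import lra.

Set Implicit Arguments.
Unset Strict Implicit.
Unset Printing Implicit Defensive.

Import Order.TTheory GRing.Theory Num.Theory.

Local Open Scope classical_set_scope.
Local Open Scope ring_scope.

(** The geometry takes place in the pseudo-metric space [msection W x0] of
    admissible sections at finite distance from [section_of W x0], which
    contains [X] isometrically through [psec]. Two admissible sections choose
    different half-spaces of the walls in a measurable set [ssep s t] of
    finite measure, and this measure is their distance. A wall in [ssep s u]
    lies in exactly one of [ssep s t] and [ssep t u], so that d(s,t) + d(t,u)
    = d(s,u) + 2 mu(ssep s t `&` ssep t u) ([sdist_defect]). The metric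
    arguments about sections all rest on this identity; for instance, the
    sections between [s] and [u] are those [t] for which [ssep s t] and [ssep
    t u] meet in a null set, and choosing on each wall the half-space
    preferred by two of three sections gives their median ([sdist_median]).

    The associated median space as a target. The walls of [X] become walls of
    the median space: the half-space [h] is lifted to the set of sections that
    contain [h] ([lift_structure]). For this to make sense on the classes of
    sections at distance 0, one representative of each class is fixed, and the
    point [x] is to be represented by [section_of W x] itself in order that
    the lifted walls restrict to the original ones. This is consistent when no
    wall separates points at distance 0; otherwise sections are not identified
    ([representatives_exist], [median_realization]).

    Dense in a median space implies tripodic. A monomorphism preserves
    distances, and a point of [X] close to the median of three points is
    almost between any two of them ([dense_in_median_tripodic]).

    Tripodic implies gated. Let [p] be a projection of [x] on a half-space
    [h], let [k] be a half-space that contains [x] and some [y] in [h], but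
    not [p]. Take [t] almost between any two of [x], [p], [y]. Quasi-convexity
    of [h] puts [t] near [h]; since [p] is almost nearest to [x] in [h], this
    makes [t] close to [p]. Quasi-convexity of [k] puts [t] near [k]. Hence
    the wall of [k] cuts a ball of fixed radius centred at [p], and local
    finiteness bounds the measure of such walls ([tripodic_gated]).

    Gated implies dense and quasi-convex. Let [p] be a projection of [x] on
    [h]. Up to measure [K], the walls between [x] and [p] separate [x] from
    all of [h] ([gated_pdist_le]). If [x] is almost between two points of [h],
    there are few such walls, so [p] is close to [x]: half-spaces are
    quasi-convex ([gated_quasi_convex]). Now let [x] almost minimize the
    distance to a section [s], and let [h] in [s] not contain [x]. Crossing a
    wall that separates [x] from [h] brings [x] nearer to [s], because [s] is
    upward closed; as moving to [p] gains at most 1, the distance from [x] to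
    [h] is at most [2 * K + 1] ([gated_near_halfspace]). All walls in [ssep s
    (psec x)] therefore cut one ball around [x], and local finiteness bounds
    the distance from [s] to [x] ([gated_dense]). *)

(** * Pseudo-metric spaces *)

Section PseudoMetricSpaces.
Context {R : realType} {T : Type} (d : T -> T -> R).

Record pseudo_metric : Prop := PseudoMetric {
  pm_ge0 : forall x y, 0 <= d x y ;
  pm_refl : forall x, d x x = 0 ;
  pm_sym : forall x y, d x y = d y x ;
  pm_triangle : forall x y z, d x z <= d x y + d y z }.

Hypothesis dP : pseudo_metric.

Lemma dist_to_le (x a : T) (A : set T) : A a -> dist_to d x A <= d x a.
Proof.
move=> Aa; apply: ge_inf; last by exists a.
by exists 0 => _ [y _ <-]; exact: pm_ge0.
Qed.

Lemma eps_projection_exists (eps : R) (x : T) (A : set T) :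
  0 < eps -> A !=set0 -> exists p, eps_projection d eps x A p.
Proof.
move=> eps0 [a Aa].
have [|_ [p Ap <-] xp] := @inf_adherent R [set d x y | y in A] _ eps0.
  split; first by exists (d x a), a.
  by exists 0 => _ [y _ <-]; exact: pm_ge0.
by exists p.
Qed.

Lemma mrepr_mproj (x : T) : d x (mrepr (mproj d x)) = 0.
Proof.
rewrite /mrepr; case: cid => y /= E.
by have : [set z | d x z = 0] y by rewrite E /= pm_refl.
Qed.

Lemma mproj_eq (x y : T) : mproj d x = mproj d y -> d x y = 0.
Proof.
move=> /(congr1 (fun C : mquot d => projT1 C)) /= E.
have : [set z | d y z = 0] y by rewrite /= pm_refl.
by rewrite -E.
Qed.

Lemma mquot_eq (C D : mquot d) : d (mrepr C) (mrepr D) = 0 -> C = D.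
Proof.
rewrite /mrepr; case: cid => x Cx; case: cid => y Dy /= xy.
have E : proj1_sig C = proj1_sig D.
  have -> : proj1_sig C = [set z | d x z = 0] by [].
  have -> : proj1_sig D = [set z | d y z = 0] by [].
  apply/seteqP; split=> z /=; have := pm_triangle dP x y z.
    have := pm_triangle dP y x z; have := pm_ge0 dP y z.
    by rewrite (pm_sym dP y x); lra.
  by have := pm_ge0 dP x z; lra.
by case: C D E {Cx Dy} => C Cx [D Dy] /=; exact: eq_exist.
Qed.

Lemma pseudo_metric_eql (x y z : T) : d x y = 0 -> d x z = d y z.
Proof.
move=> xy; have := pm_triangle dP x y z; have := pm_triangle dP y x z.
rewrite (pm_sym dP y x); lra.
Qed.

Lemma pseudo_metric_eqr (x y z : T) : d x y = 0 -> d z x = d z y.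
Proof. by rewrite !(pm_sym dP z); exact: pseudo_metric_eql. Qed.

End PseudoMetricSpaces.

(** * Measurable sets of walls of finite measure *)

Section WallMeasure.
Context {R : realType} {X : Type} (W : measured_walls R X).
Implicit Types E F : set (set (set X)).

Definition wfinite E := wmeasurable W E /\ (wmu W E < +oo)%E.

Definition wval E : R := fine (wmu W E).

Lemma wmeasurable_measurable E : wmeasurable W E ->
  measurable (E : set (g_sigma_algebraType (wmeasurable W))).
Proof. exact: sub_sigma_algebra. Qed.

Lemma wmeasurableI E F :
  wmeasurable W E -> wmeasurable W F -> wmeasurable W (E `&` F).
Proof.
have [+ _] := sigma_algebraP (@wmeasurable_sub _ _ W).
by move=> /(_ (wmeasurable_sigma W))[_ _ _]; apply.
Qed.

Lemma wmeasurableD E F :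
  wmeasurable W E -> wmeasurable W F -> wmeasurable W (E `\` F).
Proof.
move=> mE mF; have -> : E `\` F = E `&` (walls W `\` F).
  apply/seteqP; split=> w [Ew]; last by case.
  by move=> nFw; split=> //; split=> //; exact: (wmeasurable_sub mE).
by apply: wmeasurableI => //; case: (wmeasurable_sigma W) => _ + _; apply.
Qed.

Lemma wmeasurableU E F :
  wmeasurable W E -> wmeasurable W F -> wmeasurable W (E `|` F).
Proof.
move=> mE mF; rewrite -bigcup2E.
by case: (wmeasurable_sigma W) => m0 _; apply=> -[|[|n]].
Qed.

Lemma wmu_le E F :
  wmeasurable W E -> wmeasurable W F -> E `<=` F -> (wmu W E <= wmu W F)%E.
Proof.
move=> mE mF EF.
by apply: le_measure => //; rewrite inE; exact: wmeasurable_measurable.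
Qed.

Lemma wfinite_sub E F : wmeasurable W E -> wfinite F -> E `<=` F -> wfinite E.
Proof.
by move=> mE [mF fF] EF; split=> //; apply: le_lt_trans fF; exact: wmu_le.
Qed.

Lemma wfiniteU E F : wfinite E -> wfinite F -> wfinite (E `|` F).
Proof.
move=> [mE fE] [mF fF]; split; first exact: wmeasurableU.
apply: (@le_lt_trans _ _ (wmu W E + wmu W F)%E); last exact: lte_add_pinfty.
by apply: measureU2; exact: wmeasurable_measurable.
Qed.

Lemma wmu_fineK E : wfinite E -> (wval E)%:E = wmu W E.
Proof. by move=> [_ fE]; rewrite fineK// ge0_fin_numE. Qed.

Lemma wval_ge0 E : 0 <= wval E.
Proof. exact: fine_ge0. Qed.

Lemma wval_split E F : wfinite E -> wmeasurable W F ->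
  wval E = wval (E `\` F) + wval (E `&` F).
Proof.
move=> fE mF; apply: EFin_inj; rewrite EFinD !wmu_fineK//.
- by apply: measureDI; apply: wmeasurable_measurable => //; case: fE.
- apply: (wfinite_sub _ fE) => [|w []//].
  by apply: wmeasurableI => //; case: fE.
- apply: (wfinite_sub _ fE) => [|w []//].
  by apply: wmeasurableD => //; case: fE.
Qed.

Lemma wval_le E F : wmeasurable W E -> wfinite F -> E `<=` F ->
  wval E <= wval F.
Proof.
move=> mE fF EF; rewrite -lee_fin !wmu_fineK//; last exact: wfinite_sub fF EF.
by apply: wmu_le => //; case: fF.
Qed.

Lemma wval_leU E F : wfinite E -> wfinite F ->
  wval (E `|` F) <= wval E + wval F.
Proof.
move=> fE fF; rewrite -lee_fin EFinD !wmu_fineK//; last exact: wfiniteU.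
by case: fE fF => mE _ [mF _]; apply: measureU2; exact: wmeasurable_measurable.
Qed.

Lemma wval_le_at_most E A K : wfinite E -> E `<=` A -> measure_at_most W A K ->
  wval E <= K.
Proof.
by move=> fE EA; rewrite -lee_fin wmu_fineK//; apply=> //; case: fE.
Qed.

End WallMeasure.

(** * Walls on which two sections differ *)

Section Sections.
Context {R : realType} {X : Type} (W : measured_walls R X) (x0 : X).
Implicit Types s t u : set (set X).

Lemma wall_has_half (w : set (set X)) : walls W w -> exists h, w h.
Proof. by move=> /walls_partition[h ->]; exists h; left. Qed.

Definition sepw s t : set (set (set X)) :=
  walls W `&` [set w | exists2 h, w h & s h /\ ~ t h].

Lemma walls_setC (w : set (set X)) h : walls W w -> w h -> w (~` h).
Proof. by move=> Ww wh; rewrite (wall_of_mem Ww wh); right. Qed.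

(** The point [x0] excludes an empty [X], where the only half-space is its own
    complement. *)
Lemma admissible_setC s w h : admissible_section W s -> walls W w -> w h ->
  s (~` h) <-> ~ s h.
Proof.
move=> [_ us _] Ww wh; have [k [[wk sk] uk]] := us _ Ww.
have wC := walls_setC Ww wh; split=> [sC sh|nsh].
  have hC := etrans (esym (uk _ (conj wC sC))) (uk _ (conj wh sh)).
  have nhx : ~ h x0 by move=> hx; move: (hx); rewrite -hC.
  by apply: (nhx); rewrite -hC.
by move: wk sk; rewrite (wall_of_mem Ww wh) => -[->//|->].
Qed.

(** Membership of a wall can be tested on either of its half-spaces; this turns
    identities between sets of walls into propositional tautologies. *)
Lemma sepwP s t w h : admissible_section W s -> admissible_section W t ->
  walls W w -> w h -> sepw s t w <-> ~ (s h <-> t h).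
Proof.
move=> As At Ww wh.
have sC := admissible_setC As Ww wh; have tC := admissible_setC At Ww wh.
split=> [[_ [k]]|st].
  by rewrite (wall_of_mem Ww wh) => -[->|->]; tauto.
split=> //; have [sh|nsh] := pselect (s h).
  by exists h => //; tauto.
exists (~` h); first exact: walls_setC.
have [th|nth] := pselect (t h); tauto.
Qed.

Lemma symdiff_admissible s t : admissible_section W s ->
  admissible_section W t -> symdiff s t = hpreimage W (sepw s t).
Proof.
move=> As At; apply/seteqP; split=> h.
  move=> st; have [w Ww wh] : halfspaces W h.
    by case: st => -[h_in _]; [case: As|case: At] => sub _ _; exact: sub.
  split; first by exists w.
  rewrite /preimage /= -(wall_of_mem Ww wh); apply/(sepwP As At Ww wh).
  by case: st => -[]; tauto.
move=> [_]; rewrite /preimage /= => sw; have Ww := sw.1.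
have wh : wall_of h h by left.
move/(sepwP As At Ww wh): sw => st.
have [sh|nsh] := pselect (s h); [left|right]; split=> //; first tauto.
by apply: contrapT; tauto.
Qed.

Lemma wall_of_symdiff s t : admissible_section W s -> admissible_section W t ->
  wall_of @` symdiff s t = sepw s t.
Proof.
by move=> As At; rewrite symdiff_admissible// wall_of_hpreimage// => w [].
Qed.

Lemma sepw_sym s t : admissible_section W s -> admissible_section W t ->
  sepw s t = sepw t s.
Proof.
by move=> As At; apply/seteqP; split=> w sw; have Ww := sw.1;
  have [h wh] := wall_has_half Ww;
  move: sw; rewrite !(sepwP _ _ Ww wh)//; tauto.
Qed.

End Sections.

(** * The median space of sections *)

Section SectionSpace.
Context {R : realType} {X : Type} (W : measured_walls R X) (x0 : X).
Implicit Types s t u m : msection W x0.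

Definition sec s : set (set X) := projT1 s.

Definition sdist s t : R := msection_dist s t.

Lemma sec_admissible s : admissible_section W (sec s).
Proof. by case: s => s []. Qed.

Definition ssep s t : set (set (set X)) := sepw W (sec s) (sec t).

Lemma ssepP s t w h : walls W w -> w h ->
  ssep s t w <-> ~ (sec s h <-> sec t h).
Proof. exact: (sepwP x0 (sec_admissible s) (sec_admissible t)). Qed.

Lemma ssep_sym s t : ssep s t = ssep t s.
Proof. exact: (sepw_sym x0 (sec_admissible s) (sec_admissible t)). Qed.

Definition psec (x : X) : msection W x0 := exist _ _ (section_of_finite W x0 x).

Lemma sec_psec (x : X) h : sec (psec x) h <-> halfspaces W h /\ h x.
Proof. by []. Qed.

Lemma ssep_psec (x y : X) : ssep (psec x) (psec y) = wsep W [set x] [set y].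
Proof.
rewrite wsep_pointE; apply/seteqP; split=> w [Ww [h wh [hx hy]]]; split=> //;
  exists h => //; have Hh : halfspaces W h by [exists w].
  by split; [case: hx|move=> hy'; apply: hy; split].
by split; [split|case].
Qed.

Lemma ssep_cut (A : set X) h (y z : X) w : walls W w -> w h ->
  A y -> A z -> ~ (h y <-> h z) -> wcut W A w.
Proof.
move=> Ww wh Ay Az hyz; exists y, z; split=> //.
rewrite -ssep_psec; apply/(ssepP _ _ Ww wh); rewrite !sec_psec.
have : halfspaces W h by [exists w].
tauto.
Qed.

Let ssep_psec0_finite s : wfinite W (ssep s (psec x0)).
Proof.
case: s => s [As [E mE sE] fs] /=.
have := wall_of_symdiff x0 As (section_of_admissible W x0).
rewrite /ssep /=; split.
  by rewrite -H sE wall_of_hpreimage//; exact: wmeasurable_sub.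
by rewrite -H.
Qed.

Let ssep_symdiff s t : ssep s t =
  (ssep s (psec x0) `\` ssep t (psec x0)) `|`
  (ssep t (psec x0) `\` ssep s (psec x0)).
Proof.
apply/seteqP; split=> w.
  move=> st; have Ww := st.1; have [h wh] := wall_has_half Ww.
  move: st; rewrite /setU /setD /= !(ssepP _ _ Ww wh).
  have [? [? ?]] := (EM (sec s h), (EM (sec t h), EM (sec (psec x0) h))).
  tauto.
have [w0|] := pselect (walls W w); last first.
  by move=> nW [[[]]|[[]]].
have [h wh] := wall_has_half w0.
rewrite /setU /setD /= !(ssepP _ _ w0 wh); tauto.
Qed.

Lemma ssep_finite s t : wfinite W (ssep s t).
Proof.
have [ms _] := ssep_psec0_finite s; have [mt _] := ssep_psec0_finite t.
have m : wmeasurable W (ssep s t).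
  by rewrite ssep_symdiff; apply: wmeasurableU; exact: wmeasurableD.
apply: (wfinite_sub m (wfiniteU (ssep_psec0_finite s) (ssep_psec0_finite t))).
by rewrite ssep_symdiff => w [[]|[]]; [left|right].
Qed.

Lemma ssep_measurable s t : wmeasurable W (ssep s t).
Proof. by case: (ssep_finite s t). Qed.

Lemma sdistE s t : sdist s t = wval W (ssep s t).
Proof.
rewrite /sdist /msection_dist /hmu.
by rewrite (wall_of_symdiff x0 (sec_admissible s) (sec_admissible t)).
Qed.

Lemma pdistE (x y : X) : pdist W x y = sdist (psec x) (psec y).
Proof. by rewrite sdistE ssep_psec. Qed.

(** The walls that separate [t] from both [s] and [u] are the walls counted
    twice on the left and not at all in [sdist s u]. *)
Lemma sdist_defect s t u :
  sdist s t + sdist t u = sdist s u + 2 * wval W (ssep s t `&` ssep t u).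
Proof.
have E : ssep s u `\` ssep s t = ssep t u `\` ssep s t /\
         ssep s u `&` ssep s t = ssep s t `\` ssep t u.
  { split; apply/seteqP; split=> w [].
  all: move=> a b; have Ww : walls W w by [case: a|case: b].
  all: have [h wh] := wall_has_half Ww.
  all: move: a b; rewrite /setD /setI /= !(ssepP _ _ Ww wh).
  all: have [? [? ?]] := (EM (sec s h), (EM (sec t h), EM (sec u h))); tauto. }
rewrite !sdistE (wval_split (ssep_finite s t) (ssep_measurable t u)).
rewrite (wval_split (ssep_finite t u) (ssep_measurable s t)).
rewrite (wval_split (ssep_finite s u) (ssep_measurable s t)) E.1 E.2.
rewrite (setIC (ssep t u)); lra.
Qed.

Lemma sdist_pseudo_metric : pseudo_metric sdist.
Proof.
split=> [s t|s|s t|s t u]; first by rewrite sdistE wval_ge0.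
- by have := sdist_defect s s s; rewrite setIid sdistE; lra.
- by rewrite !sdistE ssep_sym.
- by rewrite sdist_defect lerDl mulr_ge0// wval_ge0.
Qed.

Definition majority (s t u : set (set X)) : set (set X) :=
  [set h | (s h /\ t h) \/ (t h /\ u h) \/ (u h /\ s h)].

Lemma majority_admissible s t u :
  admissible_section W (majority (sec s) (sec t) (sec u)).
Proof.
have [subs uns ups] := sec_admissible s.
have [subt unt upt] := sec_admissible t.
have [subu unu upu] := sec_admissible u.
split.
- by move=> h [[/subs]|[[/subt]|[/subu]]].
- move=> w Ww; have [k [[wk sk] _]] := uns _ Ww.
  have kC := walls_setC Ww wk.
  have := admissible_setC x0 (sec_admissible s) Ww wk.
  have := admissible_setC x0 (sec_admissible t) Ww wk.
  have := admissible_setC x0 (sec_admissible u) Ww wk.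
  move=> uC tC sC.
  have [mk|nmk] := pselect (majority (sec s) (sec t) (sec u) k).
    exists k; split=> // h' [wh']; move: wh'.
    rewrite (wall_of_mem Ww wk) => -[->//|->]; move: mk.
    by rewrite /majority /=; tauto.
  exists (~` k); split; last first.
    move=> h' [wh']; move: wh'.
    by rewrite (wall_of_mem Ww wk) => -[->|->].
  split=> //; move: nmk; rewrite /majority /=.
  have [? ?] := (EM (sec t k), EM (sec u k)); tauto.
- move=> h h' mh hh' Hh'; move: mh; rewrite /majority /=.
  have := ups h h'; have := upt h h'; have := upu h h'; tauto.
Qed.

Lemma majority_finite s t u :
  let m := majority (sec s) (sec t) (sec u) in
  [/\ admissible_section W m, hmeasurable W (symdiff m (section_of W x0)) &
      (hmu W (symdiff m (section_of W x0)) < +oo)%E].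
Proof.
move=> m; have Am := majority_admissible s t u.
have A0 := section_of_admissible W x0.
pose S := ssep s (psec x0); pose T := ssep t (psec x0).
pose U := ssep u (psec x0).
have E : sepw W m (section_of W x0) = (S `&` T) `|` ((T `&` U) `|` (U `&` S)).
  { apply/seteqP; split=> w H.
  all: have Ww : walls W w by [case: H => [[[]]|[[[]]|[[]]]] | exact: H.1].
  all: have [h wh] := wall_has_half Ww.
  all: move: H; rewrite (sepwP x0 Am A0 Ww wh).
  all: rewrite /S /T /U /setU /setI /= !(ssepP _ _ Ww wh) /m /majority /=.
  all: have [? [? ?]] := (EM (sec s h), (EM (sec t h), EM (sec u h))).
  all: have := EM (section_of W x0 h); tauto. }
have mE : wmeasurable W (sepw W m (section_of W x0)).
  by rewrite E; do !apply: wmeasurableU; apply: wmeasurableI;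
    exact: ssep_measurable.
split=> //.
  by exists (sepw W m (section_of W x0)) => //; exact: (symdiff_admissible x0).
rewrite /hmu (wall_of_symdiff x0 Am A0).
suff [] : wfinite W (sepw W m (section_of W x0)) by [].
apply: (wfinite_sub mE (wfiniteU (ssep_finite s (psec x0))
  (ssep_finite t (psec x0)))).
by rewrite E => w [[]|[[]|[]]]; by [left|right].
Qed.

Definition smedian s t u : msection W x0 := exist _ _ (majority_finite s t u).

Lemma sdist_interval0 s t u : Defs.interval sdist 0 s u t <->
  wval W (ssep s t `&` ssep t u) = 0.
Proof.
rewrite /Defs.interval /= sdist_defect.
have := @wval_ge0 _ _ W (ssep s t `&` ssep t u); split; lra.
Qed.

(** If [r] is between any two of the three sections, a wall on which [r] differs
    from their majority [m] is one on which [r] differs from two of them, and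
    the sections concerned are separated from [r] by a null set of common
    walls. *)
Lemma sdist_median : median sdist.
Proof.
move=> s t u; set m := smedian s t u.
have wval_set0 E : E = set0 -> wval W E = 0.
  by move=> ->; rewrite /wval measure0.
have mE h : sec m h <-> majority (sec s) (sec t) (sec u) h by [].
exists m.
  have between a b : (forall h, sec a h -> sec b h -> sec m h) ->
      (forall h, ~ sec a h -> ~ sec b h -> ~ sec m h) ->
      Defs.interval sdist 0 a b m.
    move=> mT mF; apply/sdist_interval0/wval_set0/seteqP; split=> // w [am mb].
    have Ww := am.1; have [h wh] := wall_has_half Ww.
    move: am mb; rewrite !(ssepP _ _ Ww wh).
    have := mT h; have := mF h.
    have [? [? ?]] := (EM (sec a h), (EM (sec b h), EM (sec m h))); tauto.
  by split; [split|]; apply: between => h;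
    rewrite /m /sec /= /majority /=; tauto.
move=> r [[/sdist_interval0 st /sdist_interval0 tu] /sdist_interval0 su].
apply/eqP; rewrite eq_le (pm_ge0 sdist_pseudo_metric) andbT sdistE.
set A := ssep s r `&` ssep r t in st; set B := ssep t r `&` ssep r u in tu.
set C := ssep s r `&` ssep r u in su.
have finI a b c d : wfinite W (ssep a b `&` ssep c d).
  apply: (wfinite_sub _ (ssep_finite a b)) => [|w []//].
  by apply: wmeasurableI; exact: ssep_measurable.
have [fA [fB fC]] : wfinite W A /\ wfinite W B /\ wfinite W C.
  by split; [|split]; exact: finI.
have sub : ssep m r `<=` (A `|` B) `|` C.
  move=> w mr; have Ww := mr.1; have [h wh] := wall_has_half Ww.
  move: mr; rewrite /A /B /C /setU /setI /= !(ssepP _ _ Ww wh).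
  rewrite mE /majority /=.
  have [? [? [? ?]]] :=
    (EM (sec s h), (EM (sec t h), (EM (sec u h), EM (sec r h)))); tauto.
apply: (le_trans (wval_le (ssep_measurable m r) _ sub)).
  by do !apply: wfiniteU.
rewrite (le_trans (wval_leU _ _)) ?su ?addr0//; first exact: wfiniteU.
by rewrite (le_trans (wval_leU _ _))// st tu addr0.
Qed.

End SectionSpace.

(** * Tripodic spaces, gated half-spaces and dense points *)

Section Geometry.
Context {R : realType} {X : Type} (W : measured_walls R X) (x0 : X).

Lemma pdist_pseudo_metric : pseudo_metric (pdist W).
Proof.
have [a b c t] := sdist_pseudo_metric W x0.
by split=> *; rewrite !(pdistE W x0).
Qed.

(** The walls that separate [x] from its projection [p] and cut [h] all cut one
    ball around [p], whose radius depends only on [delta] and [M]. *)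
Lemma tripodic_gated (delta M : R) : locally_finite W -> 0 <= delta -> 0 <= M ->
  tripodic (pdist W) delta -> halfspaces_quasi_convex W (2 * delta) M ->
  exists eps K : R, [/\ 0 < eps, 0 <= K & gated_halfspaces W eps K].
Proof.
move=> lf d0 M0 tri qc; have P := pdist_pseudo_metric.
(* The tripod point [t] below satisfies d(t,p) < M + 1 + 2 delta + 1, because
   [h] has a point within M + 1 of [t] and [p] is a 1-projection; the
   half-space [k] has a point within M + 1 of [t]. *)
pose r := 2 * M + 2 * delta + 3.
have [|B HB] := lf r; first by rewrite /r; lra.
exists 1, (Num.max B 0); split=> //; first by rewrite le_max lexx orbT.
move=> h x p Hh nhx [hp xp] E mE Esub.
apply: (@le_trans _ _ B%:E); last by rewrite lee_fin le_max lexx.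
apply: (HB p _ mE) => w /Esub[].
rewrite wsep_pointE => -[Ww [k wk [kx nkp]]] [y [z [hy hz yz]]].
have Hk : halfspaces W k by exists w.
have {hy hz y z yz} [y hy ky] : exists2 y, h y & k y.
  move: yz; rewrite wsep_pointE (wall_of_mem Ww wk).
  move=> [_ [_ [->|->]]] [ky nkz]; first by exists y.
  by exists z => //; exact: contrapT.
have [t [[xpt pyt] yxt]] := tri x p y.
have htM := qc h Hh p y hp hy t pyt.
have ktM := qc k Hk y x ky kx t yxt.
have [a [ha ta]] := eps_projection_exists P t ltr01 (ex_intro _ p hp).
have [b [kb tb]] := eps_projection_exists P t ltr01 (ex_intro _ x kx).
move: htM ktM xpt; rewrite /Defs.interval /= => htM ktM xpt.
have := dist_to_le P x ha; have := pm_triangle P x t a => xta xha.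
have ptb := pm_triangle P p t b; rewrite (pm_sym P p t) in ptb.
apply: (@ssep_cut _ _ W x0 _ k b p) => //; rewrite /oball /=.
- rewrite /r; lra.
- rewrite (pm_refl P) /r; lra.
- by move=> [/(_ kb)].
Qed.

(** The upward closure of a section containing the empty half-space would put
    both half-spaces of the wall of the empty set in it. *)
Lemma section_nonempty (s : msection W x0) h : sec s h -> h !=set0.
Proof.
move=> sh; apply/set0P/eqP => h0.
have [sub us up] := sec_admissible s; have [w Ww wh] := sub _ sh.
have wC := walls_setC Ww wh.
have : sec s (~` h) by apply: up sh _ _; [rewrite h0|exists w].
by move/(admissible_setC x0 (sec_admissible s) Ww wh).
Qed.

Local Notation px := (psec W x0).

(** Gatedness in the form in which it is used: [E] is a measurable set of walls
    that contains those separating [x] from the whole of [h].  The latter need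
    not form a measurable set, hence the freedom in the choice of [E]. *)
Lemma gated_pdist_le (eps K : R) h (x p : X) E : gated_halfspaces W eps K ->
  halfspaces W h -> ~ h x -> eps_projection (pdist W) eps x h p ->
  wmeasurable W E -> ssep (px x) (px p) `\` E `<=` wcut W h ->
  pdist W x p <= wval W (ssep (px x) (px p) `&` E) + K.
Proof.
move=> G Hh nhx xp mE sub; have F := ssep_finite (px x) (px p).
rewrite (pdistE W x0) sdistE (wval_split F mE) addrC lerD2l.
apply: (wval_le_at_most (A := wsep W [set x] [set p] `&` wcut W h)).
- by apply: (wfinite_sub _ F) => [|w []//]; apply: wmeasurableD => //; case: F.
- by move=> w [xpw nEw]; split; [rewrite -(ssep_psec W x0)|exact: sub].
- exact: G xp.
Qed.

Lemma gated_quasi_convex (eps K delta : R) : 0 < eps -> 0 <= K -> 0 <= delta ->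
  gated_halfspaces W eps K -> halfspaces_quasi_convex W (2 * delta) (K + delta).
Proof.
move=> e0 K0 d0 G h Hh a b ha hb x; rewrite /Defs.interval /= => abx.
have P := pdist_pseudo_metric.
have [hx|nhx] := pselect (h x).
  by apply: (le_trans (dist_to_le P x hx)); rewrite (pm_refl P) addr_ge0.
have [p xp] := eps_projection_exists P x e0 (ex_intro _ a ha).
apply: (le_trans (dist_to_le P x xp.1)).
(* The walls separating [x] from both [a] and [b]; by the defect identity they
   measure half the defect of [x] from being between [a] and [b]. *)
pose E := ssep (px a) (px x) `&` ssep (px x) (px b).
have fE : wfinite W E.
  apply: (wfinite_sub _ (ssep_finite (px a) (px x))) => [|w []//].
  by apply: wmeasurableI; exact: ssep_measurable.
have Ed : wval W E <= delta.
  have := sdist_defect (px a) (px x) (px b); rewrite -!pdistE -/E.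
  by move: abx; lra.
apply: (le_trans (gated_pdist_le (E := E) G Hh nhx xp _ _)).
- by case: fE.
- move=> w [xpw nEw]; have Ww := xpw.1; have [k wk] := wall_has_half Ww.
  have Hk : halfspaces W k by exists w.
  move: xpw nEw; rewrite /E /setI /= !(ssepP _ _ Ww wk) !sec_psec => xpw nEw.
  (* A wall between [x] and [p] outside [E] separates [p] from [a] or from [b],
     which are points of [h]. *)
  have [apk|apk] := pselect (k a <-> k p).
    apply: (ssep_cut x0 Ww wk hb xp.1); have [? ?] := (EM (k x), EM (k p)).
    have := EM (k b); tauto.
  exact: (ssep_cut x0 Ww wk ha xp.1).
rewrite addrC lerD2l; apply: le_trans Ed; apply: (wval_le _ fE) => [|w []//].
by apply: wmeasurableI; [exact: ssep_measurable|case: fE].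
Qed.

(** If a wall between [x] and [p] has [s] on the side of [x], then it cuts [h]:
    otherwise its side containing [p] would contain [h], hence belong to [s].
    So all walls between [x] and [p], but for a set of measure [K], are crossed
    towards [s] when moving from [x] to [p]; the measure of those is at most
    [K + 1] by the choice of [x]. *)
Lemma gated_near_halfspace (eps K : R) (s : msection W x0) (x : X) h :
  0 < eps -> gated_halfspaces W eps K ->
  (forall y, sdist s (px x) <= sdist s (px y) + 1) ->
  sec s h -> ~ h x -> exists2 p, h p & pdist W x p <= 2 * K + 1.
Proof.
move=> e0 G xmin sh nhx; have P := pdist_pseudo_metric.
have [p xp] := eps_projection_exists P x e0 (section_nonempty sh).
exists p; first exact: xp.1.
have [sub us up] := sec_admissible s; have Hh := sub _ sh.
have := xmin p; have := sdist_defect s (px x) (px p); rewrite -pdistE setIC.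
have : pdist W x p <= wval W (ssep (px x) (px p) `&` ssep s (px x)) + K.
  apply: (gated_pdist_le G Hh nhx xp (ssep_measurable _ _)) => w [xpw nsx].
  have Ww := xpw.1; have [_ [k wk [[Hk kx] nkp]]] := xpw.
  have skx : sec s k.
    apply: contrapT => nsk; apply: nsx; apply/(ssepP _ _ Ww wk).
    by rewrite sec_psec; tauto.
  have [y hy ky] : exists2 y, h y & k y.
    apply: contrapT => nhk.
    have : sec s (~` k).
      apply: up sh _ _; last by exists w; last exact: walls_setC Ww wk.
      by move=> y hy ky; apply: nhk; exists y.
    by move/(admissible_setC x0 (sec_admissible s) Ww wk).
  apply: (ssep_cut x0 Ww wk hy xp.1) => -[/(_ ky) kp _].
  by apply: nkp; split.
lra.
Qed.

(** A point [x] nearest to [s] up to 1 works: a wall separating [s] from [x] has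
    a half-space in [s] that misses [x] and is close to [x], so the wall cuts a
    ball around [x] whose radius depends only on [K]. *)
Lemma gated_dense (eps K : R) : locally_finite W -> 0 < eps -> 0 <= K ->
  gated_halfspaces W eps K ->
  exists2 delta, 0 <= delta &
    forall s : msection W x0, exists x, sdist (px x) s <= delta.
Proof.
move=> lf e0 K0 G; have P := sdist_pseudo_metric W x0.
have [|B HB] := lf (2 * K + 2); first by lra.
exists (Num.max B 0); first by rewrite le_max lexx orbT.
move=> s.
have [|_ [[x _ <-] smin]] := eps_projection_exists P s ltr01 (A := range px).
  by exists (px x0), x0.
exists x; rewrite (pm_sym P) sdistE le_max; apply/orP; left.
apply: (wval_le_at_most (ssep_finite _ _) _ (HB x)) => w [Ww [h wh [sh nxh]]].
have Hh : halfspaces W h by exists w.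
have nhx : ~ h x by move=> hx; apply: nxh.
have [|p hp xp] := gated_near_halfspace e0 G _ sh nhx.
  move=> y; have := dist_to_le P s (A := range px) (ex_intro2 _ _ y I erefl).
  by move: smin; lra.
have Q := pdist_pseudo_metric.
apply: (@ssep_cut _ _ W x0 _ h p x) => //; rewrite /oball /=.
- by move: xp; lra.
- by rewrite (pm_refl Q); lra.
- by move=> [/(_ hp)].
Qed.

End Geometry.

(** * Lifting the walls to a space of sections *)

(** [r] realizes the points of [Y] as sections, and [phi] embeds [X] in [Y] in
    such a way that points are realized by their own sections. *)
Section LiftedWalls.
Context {R : realType} {X Y : Type} (W : measured_walls R X) (x0 : X).
Variables (r : Y -> msection W x0) (phi : X -> Y).
Hypothesis r_phi : forall x, sec (r (phi x)) = section_of W x.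

Definition lift_half (h : set X) : set Y := [set y | sec (r y) h].

Definition lift_wall (w : set (set X)) : set (set Y) := lift_half @` w.

Lemma lift_wallE w h : walls W w -> w h -> lift_wall w = wall_of (lift_half h).
Proof.
move=> Ww wh; have C : lift_half (~` h) = ~` lift_half h.
  by apply/funext => y; apply/propext;
    exact: (admissible_setC x0 (sec_admissible (r y)) Ww wh).
rewrite /lift_wall (wall_of_mem Ww wh) /wall_of -C; apply/seteqP; split.
  by move=> _ [_ [->|->] <-]; [left|right].
by move=> _ [->|->]; [exists h; [left|]|exists (~` h); [right|]].
Qed.

Lemma phi_lift_half h : halfspaces W h -> phi @^-1` lift_half h = h.
Proof.
move=> Hh; apply/seteqP; split=> x; rewrite /preimage /lift_half /= r_phi.
  by case.
by [].
Qed.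

Lemma lift_wallK w : walls W w -> wall_pullback phi (lift_wall w) = w.
Proof.
move=> Ww; rewrite /wall_pullback /lift_wall; apply/seteqP; split=> h.
  by move=> [_ [k wk <-] <-]; rewrite phi_lift_half//; exists w.
move=> wh; exists (lift_half h); first by exists h.
by rewrite phi_lift_half//; exists w.
Qed.

Lemma lift_wall_inj v w : walls W v -> walls W w -> lift_wall v = lift_wall w ->
  v = w.
Proof. by move=> Wv Ww vw; rewrite -(lift_wallK Wv) vw lift_wallK. Qed.

Definition lift_walls := lift_wall @` walls W.

Definition lift_measurable := [set lift_wall @` E | E in wmeasurable W].

Lemma lift_walls_partition v : lift_walls v -> exists h, v = wall_of h.
Proof.
move=> [w Ww <-]; have [h wh] := wall_has_half Ww.
by exists (lift_half h); exact: lift_wallE.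
Qed.

Lemma lift_measurable_sub E : lift_measurable E -> E `<=` lift_walls.
Proof.
by move=> [F mF <-] _ [w Fw <-]; exists w => //; exact: (wmeasurable_sub mF).
Qed.

Lemma lift_measurable_sigma : sigma_algebra lift_walls lift_measurable.
Proof.
have [m0 mC mU] := wmeasurable_sigma W; split.
- by exists set0 => //; rewrite image_set0.
- move=> _ [E mE <-]; exists (walls W `\` E); first exact: mC.
  apply/seteqP; split=> v.
    move=> [w [Ww nEw] <-]; split; first by exists w.
    move=> [u Eu uw]; apply: nEw; rewrite -(lift_wall_inj _ Ww uw)//.
    exact: (wmeasurable_sub mE).
  move=> [[w Ww <-] nE]; exists w => //; split=> //.
- move=> F mF.
  have /choice[G mG] n : exists G, wmeasurable W G /\ lift_wall @` G = F n.
    by have [G] := mF n; exists G.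
  exists (\bigcup_k G k); first by apply: mU => n; case: (mG n).
  by rewrite image_bigcup; apply: eq_bigcupr => n _; case: (mG n).
Qed.

(** The measure on the lifted walls is an image measure, and this requires a map
    defined on all sets of subsets of [X].  The empty set is never a wall, so
    sending everything but the walls to it keeps the preimage of a set of lifted
    walls inside the walls. *)
Definition lift_total (w : g_sigma_algebraType (wmeasurable W)) :
    g_sigma_algebraType lift_measurable :=
  if pselect (walls W w) then lift_wall w else set0.

Lemma preimage_lift_total E : wmeasurable W E ->
  lift_total @^-1` (lift_wall @` E) = E.
Proof.
move=> mE.
apply/seteqP; split=> w; rewrite /preimage /= /lift_total; last first.
  move=> Ew; case: pselect => [Ww|]; first by exists w.
  by have := wmeasurable_sub mE Ew.
case: pselect => [Ww [u Eu uw]|nWw [u Eu u0]].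
  by rewrite -(lift_wall_inj _ Ww uw)//; exact: (wmeasurable_sub mE).
have [h uh] := wall_has_half (wmeasurable_sub mE Eu).
have : lift_wall u (lift_half h) by exists h.
by rewrite u0.
Qed.

Lemma lift_total_measurable : measurable_fun setT lift_total.
Proof.
apply: (@measurability _ _ _ _ setT lift_total lift_measurable) => //.
move=> _ [_ [E mE <-] <-].
rewrite setTI preimage_lift_total//; exact: wmeasurable_measurable.
Qed.

Definition lift_mu :
    {measure set (g_sigma_algebraType lift_measurable) -> \bar R} :=
  measure_function_pushforward__canonical__measure_function_Measure
    (wmu W) lift_total_measurable.

Lemma lift_muE E : wmeasurable W E -> lift_mu (lift_wall @` E) = wmu W E.
Proof. by move=> mE; rewrite -[in RHS](preimage_lift_total mE). Qed.

Let lift_sepE (y z : Y) :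
  lift_walls `&` [set v | exists2 k, v k & k y /\ ~ k z] =
  lift_wall @` ssep (r y) (r z).
Proof.
apply/seteqP; split=> v.
  move=> [[w Ww <-] [_ [h wh <-] hyz]]; exists w => //; split=> //.
  by exists h.
move=> [w [Ww [h wh hyz]] <-]; split; first by exists w.
by exists (lift_half h) => //; exists h.
Qed.

Lemma lift_sep_measurable (y z : Y) :
  lift_measurable (lift_walls `&` [set v | exists2 k, v k & k y /\ ~ k z]).
Proof.
by rewrite lift_sepE; exists (ssep (r y) (r z)); first exact: ssep_measurable.
Qed.

Lemma lift_sep_finite (y z : Y) :
  (lift_mu (lift_walls `&` [set v | exists2 k, v k & k y /\ ~ k z]) < +oo)%E.
Proof.
rewrite lift_sepE lift_muE; last exact: ssep_measurable.
by case: (ssep_finite (r y) (r z)).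
Qed.

Definition lift_structure : measured_walls R Y :=
  MeasuredWalls lift_walls_partition lift_measurable_sub lift_measurable_sigma
    lift_sep_measurable lift_sep_finite.

Lemma pdist_lift (y z : Y) : pdist lift_structure y z = sdist (r y) (r z).
Proof.
rewrite /pdist wsep_pointE lift_sepE lift_muE; last exact: ssep_measurable.
by rewrite sdistE.
Qed.

Lemma lift_monomorphism : monomorphism W lift_structure phi.
Proof.
split; last by move=> w Ww; exists (lift_wall w); [exists w|exact: lift_wallK].
split=> [_ [w Ww <-]|E mE]; first by rewrite lift_wallK.
have -> : walls lift_structure `&` wall_pullback phi @^-1` E = lift_wall @` E.
  apply/seteqP; split=> v.
    move=> [[w Ww <-]]; rewrite /preimage /= lift_wallK// => Ew.
    by exists w.
  move=> [w Ew <-]; have Ww := wmeasurable_sub mE Ew.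
  by split; [exists w|rewrite /preimage /= lift_wallK].
by split; [exists E|exact: lift_muE].
Qed.

End LiftedWalls.

(** * Spaces dense in a median space *)

Section Isometry.
Context {R : realType} {X Y : Type}.
Context (W : measured_walls R X) (V : measured_walls R Y) (phi : X -> Y).

Lemma homomorphism_isometry : homomorphism W V phi ->
  forall x y, pdist V (phi x) (phi y) = pdist W x y.
Proof.
move=> [hw hmu] x y; have mE : wmeasurable W (wsep W [set x] [set y]).
  by rewrite wsep_pointE; exact: wsep_measurable.
rewrite /pdist -(hmu _ mE).2; congr (fine (wmu V _)).
rewrite !wsep_pointE; apply/seteqP; split=> v [Vv].
  move=> [k vk [kx ky]]; split=> //; split; first exact: hw.
  by exists (phi @^-1` k) => //; exists k.
by move=> [_ [_ [k vk <-] [kx ky]]]; split=> //; exists k.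
Qed.

Lemma dense_in_median_tripodic (delta : R) : homomorphism W V phi ->
  pseudo_metric (pdist V) -> median (pdist V) ->
  hausdorff_le (pdist V) (range phi) setT delta -> tripodic (pdist W) delta.
Proof.
move=> hphi P med [_ dense] x y z.
have [m [[mxy myz] mxz] _] := med (phi x) (phi y) (phi z).
have [_ [t _ <-] tm] := dense m I.
exists t; move: mxy myz mxz.
rewrite /Defs.interval /setI /= -!(homomorphism_isometry hphi) !addr0.
have := pm_triangle P (phi x) m (phi t).
have := pm_triangle P (phi y) m (phi t).
have := pm_triangle P (phi z) m (phi t).
have := (pm_sym P (phi t) (phi x), pm_sym P (phi t) (phi y)).
have := (pm_sym P (phi t) (phi z), pm_sym P m (phi t)).
have := (pm_sym P m (phi x), pm_sym P m (phi y)).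
have := (pm_sym P m (phi z), pm_sym P (phi z) (phi x)).
move=> [? ?] [? ?] [? ?] [? ?] *.
split; [split|]; lra.
Qed.

End Isometry.

(** * Realization of the associated median space as a space with walls *)

Section Realization.
Context {R : realType} {X : Type} (W : measured_walls R X) (x0 : X).

Lemma sdist_eq_sec (s s' t : msection W x0) : sec s = sec s' ->
  sdist s t = sdist s' t.
Proof. by move=> E; rewrite !sdistE /ssep E. Qed.

Lemma median_of_distE (s t : msection W x0) :
  median_of_dist (mproj _ s) (mproj _ t) = sdist s t.
Proof.
have P := sdist_pseudo_metric W x0.
rewrite /median_of_dist /mquot_dist -/(sdist _ _).
rewrite -(pseudo_metric_eql P _ (mrepr_mproj P s)).
by rewrite -(pseudo_metric_eqr P _ (mrepr_mproj P t)).
Qed.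

(** When no wall separates points at distance 0, two points with the same class
    have the same section, so every class in the image of [X] can be represented
    by the section of a point.  Otherwise [Y] is the space of all sections,
    where no choice is needed. *)
Lemma representatives_exist :
  exists (Y : Type) (r : Y -> msection W x0) (phi : X -> Y),
  [/\ forall x, sec (r (phi x)) = section_of W x,
      forall s, exists y, sdist (r y) s = 0 &
      null_walls_absent W -> forall y z, sdist (r y) (r z) = 0 -> y = z].
Proof.
have P := sdist_pseudo_metric W x0.
have [nwa|] := pselect (null_walls_absent W); last first.
  move=> nwa; exists (msection W x0), id, (psec W x0); split=> // s.
  by exists s; exact: pm_refl P s.
pose r (C : median_of W x0) : msection W x0 :=
  if pselect (exists x, C = miota W x0 x) is left e
  then psec W x0 (projT1 (cid e))
  else mrepr C.
have rE C : sdist (r C) (mrepr C) = 0.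
  rewrite /r; case: pselect => [e|_]; last exact: pm_refl P _.
  by case: (cid e) => x /= ->; exact: (mrepr_mproj P).
exists (median_of W x0), r, (miota W x0); split.
- move=> x; rewrite /r; case: pselect => [e|]; last by case; exists x.
  case: (cid e) => y /= /(mproj_eq P) xy.
  have sxy := nwa _ _ (etrans (pdistE W x0 x y) xy).
  { apply/seteqP; split=> h [[w Ww wh] hh];
      have Hh : halfspaces W h by [exists w].
  all: suff : sec (psec W x0 x) h <-> sec (psec W x0 y) h
    by rewrite !sec_psec /section_of /setI /=; tauto.
  all: apply: contrapT => /(ssepP _ _ Ww wh); rewrite ssep_psec sxy.
  all: by []. }
- move=> s; exists (mproj _ s).
  rewrite (pseudo_metric_eql P _ (rE _)) (pm_sym P); exact: (mrepr_mproj P).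
- move=> _ C D rCD; apply: (mquot_eq P).
  by rewrite -(pseudo_metric_eql P _ (rE C)) -(pseudo_metric_eqr P _ (rE D)).
Qed.

Lemma median_realization (delta : R) :
  hausdorff_le (@median_of_dist R X W x0) (range (miota W x0)) setT delta ->
  0 <= delta ->
  exists (Y : Type) (V : measured_walls R Y) (phi : X -> Y),
    [/\ median_target W V, monomorphism W V phi &
        hausdorff_le (pdist V) (range phi) setT delta].
Proof.
move=> [_ dense] d0; have P := sdist_pseudo_metric W x0.
have [Y [r [phi [rphi rsurj rinj]]]] := representatives_exist.
pose V := lift_structure rphi; exists Y, V, phi; split.
- split; last by move=> nwa y z; rewrite pdist_lift; exact: rinj.
  move=> y1 y2 y3.
  have [m mI um] := sdist_median (r y1) (r y2) (r y3).
  have [y ym] := rsurj m.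
  exists y.
    move: mI; rewrite /Defs.interval /setI /= !pdist_lift.
    by rewrite !(pseudo_metric_eql P _ ym) !(pseudo_metric_eqr P _ ym).
  move=> t tI; rewrite pdist_lift (pseudo_metric_eql P _ ym); apply: um.
  by move: tI; rewrite /Defs.interval /setI /= !pdist_lift.
- exact: lift_monomorphism.
split=> [y _|y _].
  by exists y => //; rewrite pdist_lift (pm_refl P).
have [_ [x _ <-]] := dense (mproj _ (r y)) I.
rewrite median_of_distE => xy.
exists (phi x); first by exists x.
by rewrite pdist_lift (@sdist_eq_sec _ (psec W x0 x)).
Qed.

End Realization.

Theorem theorem4p14 (R : realType) (X : Type) (W : measured_walls R X)
    (x0 : X) (hW : locally_finite W) :
  [<->
    exists delta M : R, [/\ 0 <= delta, 0 <= M,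
      hausdorff_le (@median_of_dist R X W x0)
        (range (miota W x0)) setT delta &
      halfspaces_quasi_convex W (2 * delta) M];
    exists delta M : R, [/\ 0 <= delta, 0 <= M,
      exists (Y : Type) (V : measured_walls R Y) (phi : X -> Y),
        [/\ median_target W V, monomorphism W V phi &
            hausdorff_le (pdist V) (range phi) setT delta] &
      halfspaces_quasi_convex W (2 * delta) M];
    exists delta M : R, [/\ 0 <= delta, 0 <= M,
      tripodic (pdist W) delta &
      halfspaces_quasi_convex W (2 * delta) M];
    exists eps K : R, [/\ 0 < eps, 0 <= K & gated_halfspaces W eps K]].
Proof.
tfae.
- move=> [delta [M [d0 M0 dense qc]]]; exists delta, M; split=> //.
  exact: median_realization dense d0.
- move=> [delta [M [d0 M0 [Y [V [phi [[med _] [hphi _] dense]]]] qc]]].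
  exists delta, M; split=> //.
  have P := pdist_pseudo_metric V (phi x0).
  exact: dense_in_median_tripodic hphi P med dense.
- move=> [delta [M [d0 M0 tri qc]]].
  exact: tripodic_gated x0 _ _ hW d0 M0 tri qc.
- move=> [eps [K [e0 K0 G]]].
  have [delta d0 dense] := gated_dense x0 hW e0 K0 G.
  exists delta, (K + delta); split=> //; first exact: addr_ge0.
    split=> [C _|C _].
      exists C => //; rewrite /median_of_dist /mquot_dist -/(sdist _ _).
      by rewrite (pm_refl (sdist_pseudo_metric W x0)).
    have [x xC] := dense (mrepr C).
    exists (miota W x0 x); first by exists x.
    rewrite /median_of_dist /mquot_dist -/(sdist _ _).
    have P := sdist_pseudo_metric W x0.
    by rewrite -(pseudo_metric_eql P _ (mrepr_mproj P (psec W x0 x))).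
  exact: (gated_quasi_convex x0 e0 K0 d0 G).
Qed.
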